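(* Let $n,m\ge1$ and $r\ge0$ be integers. Then $\mathcal{C}_r^{n,m}$ is a closed convex cone in $\mathcal{S}^{n,m}$, and thus $\mathcal{K}_{\mathrm{NN},r}^{n,m}(\mathbb{R}_+^n)$ and $\mathcal{C}_r^{n,m}$ are dual to each other, i.e. $\mathcal{K}_{\mathrm{NN},r}^{n,m}(\mathbb{R}_+^n)=(\mathcal{C}_r^{n,m})^*$ and $\mathcal{K}_{\mathrm{NN},r}^{n,m}(\mathbb{R}_+^n)^*=\mathcal{C}_r^{n,m}$.
   Context: $\mathcal{S}^{n,k}$ is the space of symmetric tensors of order $k$ over $\mathbb{R}^n$ (real $k$-dimensional arrays of side $n$ invariant under permutation of indices) with inner product $\langle\mathcal{A},\mathcal{B}\rangle=\sum_{i_1,\dots,i_k}\mathcal{A}_{i_1\cdots i_k}\mathcal{B}_{i_1\cdots i_k}$; $\boldsymbol{x}^{\otimes k}$ has entries $x_{i_1}\cdots x_{i_k}$; $\mathscr{S}$ is the symmetrization map on tensors (average over all permutations of the tensor factors). For a cone $\mathcal{K}$, $\mathcal{K}^*=\{x\mid\langle x,y\rangle\ge0\ \forall y\in\mathcal{K}\}$ is its dual cone in the ambient space. A cone is a nonempty set closed under multiplication by positive scalars. $\mathrm{SOS}^{n,2k}(\mathbb{R}^n)=\operatorname{conv}\{\mathscr{S}(\mathcal{B}\otimes\mathcal{B})\mid\mathcal{B}\in\mathcal{S}^{n,k}\}\subseteq\mathcal{S}^{n,2k}$ and $\mathrm{MOM}^{n,2k}(\mathbb{R}^n)=\mathrm{SOS}^{n,2k}(\mathbb{R}^n)^*$.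 For $\boldsymbol{x}\in\mathbb{R}^n$ let $\boldsymbol{x}\circ\boldsymbol{x}=(x_1^2,\dots,x_n^2)$. For $\mathcal{A}\in\mathcal{S}^{n,m}$, $\mathcal{A}^{(r)}$ is the unique element of $\mathcal{S}^{n,2(r+m)}$ with $(\boldsymbol{x}^\top\boldsymbol{x})^r\langle\mathcal{A},(\boldsymbol{x}\circ\boldsymbol{x})^{\otimes m}\rangle=\langle\mathcal{A}^{(r)},\boldsymbol{x}^{\otimes2(r+m)}\rangle$ for all $\boldsymbol{x}\in\mathbb{R}^n$. Then $\mathcal{K}_{\mathrm{NN},r}^{n,m}(\mathbb{R}_+^n)=\{\mathcal{A}\in\mathcal{S}^{n,m}\mid\mathcal{A}^{(r)}\in\mathrm{SOS}^{n,2(r+m)}(\mathbb{R}^n)\}$. $\mathcal{C}^{(r)}:\mathcal{S}^{n,2(r+m)}\to\mathcal{S}^{n,m}$ is the adjoint of $\mathcal{A}\mapsto\mathcal{A}^{(r)}$, i.e. $\langle\mathcal{A},\mathcal{C}^{(r)}(\mathcal{X})\rangle=\langle\mathcal{A}^{(r)},\mathcal{X}\rangle$ for all $\mathcal{A},\mathcal{X}$, and $\mathcal{C}_r^{n,m}=\{\mathcal{C}^{(r)}(\mathcal{X})\mid\mathcal{X}\in\mathrm{MOM}^{n,2(r+m)}(\mathbb{R}^n)\}$. *)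

(* Defs.v *)
From HB Require Import structures.
From mathcomp Require Import all_boot all_order all_algebra all_fingroup.
From mathcomp Require Import all_classical all_reals all_analysis.

Import Order.TTheory GRing.Theory Num.Theory.
Import numFieldNormedType.Exports.

Local Open Scope classical_set_scope.
Local Open Scope ring_scope.

(* The topology is that of entrywise convergence, i.e. the Euclidean topology,
   as there are finitely many entries. *)
Definition tensor (R : realType) (n k : nat) : Type :=
  {ffun 'I_k -> 'I_n} -> R.

#[warnings="-redundant-canonical-projection"]
HB.instance Definition _ (R : realType) (n k : nat) :=
  GRing.Lmodule.copy (tensor R n k) ({ffun 'I_k -> 'I_n} -> R^o).
#[warnings="-redundant-canonical-projection"]
HB.instance Definition _ (R : realType) (n k : nat) :=
  Topological.copy (tensor R n k) {ptws {ffun 'I_k -> 'I_n} -> R}.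

Definition tdot {R : realType} {n k : nat} (A B : tensor R n k) : R :=
  \sum_i A i * B i.

Definition permute_idx {n k : nat} (s : 'S_k) (i : {ffun 'I_k -> 'I_n}) :
  {ffun 'I_k -> 'I_n} := [ffun j => i (s j)].

Definition symt {R : realType} {n k : nat} : set (tensor R n k) :=
  [set A | forall (s : 'S_k) i, A (permute_idx s i) = A i].

Definition symmetrize {R : realType} {n k : nat} (A : tensor R n k) :
    tensor R n k :=
  fun i => (k`!%:R)^-1 * \sum_(s : 'S_k) A (permute_idx s i).

Definition tprod {R : realType} {n k l : nat}
    (A : tensor R n k) (B : tensor R n l) : tensor R n (k + l) :=
  fun i => A [ffun j => i (lshift l j)] * B [ffun j => i (rshift k j)].

Definition tpow {R : realType} {n : nat} (x : 'cV[R]_n) (k : nat) :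
    tensor R n k :=
  fun i => \prod_(j < k) x (i j) 0.

Definition hadamard_sq {R : realType} {n : nat} (x : 'cV[R]_n) : 'cV[R]_n :=
  \col_i (x i 0 ^+ 2).

Definition is_cone {R : realType} {n k : nat} (K : set (tensor R n k)) :=
  K !=set0 /\ forall t A, 0 < t -> K A -> K (t *: A).

(* The ambient space is that of symmetric tensors. *)
Definition dual_cone {R : realType} {n k : nat} (K : set (tensor R n k)) :
    set (tensor R n k) :=
  [set A | symt A /\ forall B, K B -> 0 <= tdot A B].

Definition conv_hull {R : realType} {n k : nat} (X : set (tensor R n k)) :
    set (tensor R n k) :=
  smallest (fun C => convex_set C) X.

(* The order 2k is written k + k, the type of B (x) B; likewise 2(r + m) below
   is (r + m) + (r + m). *)
Definition SOS (R : realType) (n k : nat) : set (tensor R n (k + k)) :=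
  conv_hull [set symmetrize (tprod B B) | B in @symt R n k].

Definition MOM (R : realType) (n k : nat) : set (tensor R n (k + k)) :=
  dual_cone (SOS R n k).

(* A^(r). For symmetric A exactly one B satisfies the condition, because
   symmetric tensors correspond bijectively to forms of the same degree; so the
   default value of xget is irrelevant there. *)
Definition lift_sq {R : realType} {n m : nat} (r : nat) (A : tensor R n m) :
    tensor R n ((r + m) + (r + m)) :=
  xget 0 [set B | symt B /\ forall x : 'cV[R]_n,
    (x^T *m x) 0 0 ^+ r * tdot A (tpow (hadamard_sq x) m) =
    tdot B (tpow x ((r + m) + (r + m)))].

Definition KNN (R : realType) (n m r : nat) : set (tensor R n m) :=
  [set A | symt A /\ SOS R n (r + m) (lift_sq r A)].

(* C^(r). The adjoint is between spaces of symmetric tensors: Y must be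
   symmetric and is tested against symmetric A only, which determines it. *)
Definition adj_lift_sq {R : realType} {n m r : nat}
    (X : tensor R n ((r + m) + (r + m))) : tensor R n m :=
  xget 0 [set Y | symt Y /\ forall A, symt A ->
    tdot A Y = tdot (lift_sq r A) X].

Definition Ccone (R : realType) (n m r : nat) : set (tensor R n m) :=
  [set adj_lift_sq X | X in MOM R n (r + m)].

(* Main.v *)
Require Import Defs.
From mathcomp Require Import all_boot all_order all_algebra all_fingroup.
From mathcomp Require Import all_classical all_reals all_analysis.
From mathcomp Require Import ring lra.

Import Order.TTheory GRing.Theory Num.Theory.
Import numFieldNormedType.Exports.

Set Implicit Arguments.
Unset Strict Implicit.
Unset Printing Implicit Defensive.

Local Open Scope classical_set_scope.
Local Open Scope ring_scope.

(* Dualizing turns the statement into two closedness facts, by the bipolar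
   theorem, proved with nearest points. The map X |-> C^(r)(X) is a partial
   trace followed by symmetrization, so the entries of C^(r)(X) sum to the trace
   of X seen as a matrix on multi-indices. On MOM this matrix is positive
   semidefinite, so the trace bounds every entry, and a continuous image of a
   closed set along which preimages stay bounded is closed.
   Likewise SOS is the image under symmetrization of the cone of positive
   semidefinite Gram matrices with symmetric columns. The trace of such a matrix
   is bounded by the symmetrized tensor: split G into squares b (x) b by pivoting
   and recover the entries of the symmetric tensors b from values of their forms
   by polarization. *)

(** * Topology of tensor spaces: continuity, compactness, closed sets *)

Section Topology.
Context {R : realType} {n k : nat}.
Implicit Types A B C X : tensor R n k.

Lemma addtE A B i : (A + B) i = A i + B i. Proof. by []. Qed.
Lemma opptE A i : (- A) i = - A i. Proof. by []. Qed.
Lemma scaletE (c : R) A i : (c *: A) i = c * A i. Proof. by []. Qed.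

Lemma coord_continuous i : continuous (fun A => A i).
Proof. exact: (@proj_continuous _ (fun=> R) i). Qed.

Lemma sum_continuous (T : topologicalType) (I : Type) (s : seq I) (P : pred I)
    (f : I -> T -> R) :
  (forall i, continuous (f i)) -> continuous (fun x => \sum_(i <- s | P i) f i x).
Proof.
move=> fc x; elim: s => [|a s IH].
  have -> : (fun x => \sum_(i <- [::] | P i) f i x) = cst 0.
    by apply: funext => y; rewrite big_nil.
  exact: cst_continuous.
have -> : (fun x => \sum_(i <- a :: s | P i) f i x) =
  (fun x => (if P a then f a x else 0) + \sum_(i <- s | P i) f i x).
  by apply: funext => y; rewrite big_cons; case: ifP => // _; rewrite add0r.
by case: (P a); apply: cvgD => //; [exact: fc|exact: cvg_cst].
Qed.

Lemma scale_continuous (T : topologicalType) (c : R) (f : T -> R) :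
  continuous f -> continuous (fun x => c * f x).
Proof. by move=> fc x; have H := cvgM (cvg_cst c) (fc x); exact: H. Qed.

Lemma tdot_continuous (T : topologicalType) (f g : T -> tensor R n k) :
  (forall i, continuous (fun x => f x i)) ->
  (forall i, continuous (fun x => g x i)) ->
  continuous (fun x => tdot (f x) (g x)).
Proof.
move=> fc gc; rewrite /tdot.
apply: sum_continuous => i x; apply: cvgM; [exact: fc|exact: gc].
Qed.

Lemma tensor_continuous (T : topologicalType) (f : T -> tensor R n k) :
  (forall i, continuous (fun x => f x i)) -> continuous f.
Proof.
move=> fc x; apply/cvg_sup => i; apply/cvg_image.
  by apply/seteqP; split => // y _; exists (fun=> y).
move=> U /= nU; exists ((fun A => A i) @^-1` U); last first.
  by rewrite image_preimage//; apply/seteqP; split => // y _; exists (fun=> y).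
exact: fc.
Qed.

Lemma tensor_hausdorff : hausdorff_space (tensor R n k).
Proof. by apply: (@hausdorff_product _ (fun=> R)) => _; exact: Rhausdorff. Qed.

Lemma bounded_closed_compact_tensor (K : set (tensor R n k)) (M : R) :
  closed K -> (forall X i, K X -> `|X i| <= M) -> compact K.
Proof.
move=> Kc Kb.
have : compact [set X : tensor R n k | forall i, [set` `[- M, M]%R] (X i)].
  apply: (@tychonoff _ (fun=> R) (fun=> [set` `[- M, M]%R])) => _.
  exact: segment_compact.
move=> cB; apply: (@subclosed_compact (tensor R n k) K _ Kc cB).
by move=> X KX i /=; rewrite in_itv/= -ler_norml; exact: Kb.
Qed.

Lemma closed_ge_fun (T : topologicalType) (f : T -> R) (c : R) :
  continuous f -> closed [set X | c <= f X].
Proof.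
move=> fc; apply: (@preimage_closed _ _ f [set y | c <= y]); last exact: closed_ge.
by move=> x _; exact: fc.
Qed.

Lemma closed_le_fun (T : topologicalType) (f : T -> R) (c : R) :
  continuous f -> closed [set X | f X <= c].
Proof.
move=> fc; apply: (@preimage_closed _ _ f [set y | y <= c]); last exact: closed_le.
by move=> x _; exact: fc.
Qed.

Lemma closed_eq_fun (T : topologicalType) (f g : T -> R) :
  continuous f -> continuous g -> closed [set X | f X = g X].
Proof.
move=> fc gc.
have -> : [set X | f X = g X] = [set X | 0 <= - `|f X - g X|].
  apply/seteqP; split => X /=; first by move=> ->; rewrite subrr normr0 oppr0.
  by rewrite oppr_ge0 normr_le0 subr_eq0 => /eqP.
apply: closed_ge_fun => x; apply: cvgN; apply: cvg_norm.
by apply: (@cvgB _ _ _ _ _ f g); [exact: fc|exact: gc].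
Qed.

Lemma closed_forall (T : topologicalType) (I : Type) (P : I -> set T) :
  (forall i, closed (P i)) -> closed [set X | forall i, P i X].
Proof.
move=> Pc; have -> : [set X | forall i, P i X] = \bigcap_i P i.
  by apply/seteqP; split => X /= PX i //; exact: PX.
by apply: closed_bigI => i _.
Qed.

End Topology.

(** Near a limit point [Y] the continuous function [g] stays below [g Y + 1], so only points of [K]
    with entries below that bound matter. They form a compact set, whose image is compact and hence
    closed. *)
Lemma closed_image_tensor (R : realType) (n k l : nat)
    (K : set (tensor R n k)) (f : tensor R n k -> tensor R n l)
    (g : tensor R n l -> R) :
  closed K -> (forall i, continuous (fun X => f X i)) -> continuous g ->
  (forall X i, K X -> `|X i| <= g (f X)) -> closed (f @` K).
Proof.
move=> Kc fc gc Kb Y clY.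
pose M := g Y + 1; pose K' := K `&` [set X | forall i, `|X i| <= M].
have K'c : closed K'.
  apply: closedI => //; apply: closed_forall => i.
  apply: (@closed_le_fun _ _ (fun X : tensor R n k => `|X i|)) => X.
  have H := cvg_norm (@coord_continuous R n k i X); exact: H.
have : closed (f @` K').
  apply: (@compact_closed (tensor R n l)); first exact: tensor_hausdorff.
  apply: continuous_compact.
    by apply: continuous_subspaceT; exact: tensor_continuous.
  by apply: (bounded_closed_compact_tensor (M := M)) => // X i [_]; exact.
move=> /(_ Y) H; suff : (f @` K') Y by case=> X [KX _] <-; exists X.
apply: H => U nU.
have nV : nbhs Y [set Z | g Z < M].
  have : nbhs (g Y) [set y | y < M].
    by apply: open_nbhs_nbhs; split; [exact: open_lt|rewrite /= /M ltrDl].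
  exact: gc.
have [Z [[X KX XZ] [UZ gZ]]] := clY _ (filterI nU nV).
exists Z; split => //; exists X => //; split => //= i.
by apply: (le_trans (Kb _ _ KX)); rewrite XZ ltW.
Qed.

(** * Inner product, nearest points and the bipolar theorem *)

Section Bipolar.
Context {R : realType} {n k : nat}.
Implicit Types A B C X : tensor R n k.

Lemma tdotC A B : tdot A B = tdot B A.
Proof. by rewrite /tdot; apply: eq_bigr => i _; rewrite mulrC. Qed.

Lemma tdotDl A B C : tdot (A + B) C = tdot A C + tdot B C.
Proof. by rewrite /tdot -big_split; apply: eq_bigr => i _; rewrite addtE mulrDl. Qed.

Lemma tdotZl c A B : tdot (c *: A) B = c * tdot A B.
Proof. by rewrite /tdot mulr_sumr; apply: eq_bigr => i _; rewrite scaletE mulrA. Qed.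

Lemma tdotNl A B : tdot (- A) B = - tdot A B.
Proof. by rewrite -scaleN1r tdotZl mulN1r. Qed.

Lemma tdotDr A B C : tdot C (A + B) = tdot C A + tdot C B.
Proof. by rewrite tdotC tdotDl !(tdotC C). Qed.

Lemma tdotZr c A B : tdot A (c *: B) = c * tdot A B.
Proof. by rewrite tdotC tdotZl tdotC. Qed.

Lemma tdotNr A B : tdot A (- B) = - tdot A B.
Proof. by rewrite tdotC tdotNl tdotC. Qed.

Lemma tdot_line (t : R) A B : tdot (A + t *: B) (A + t *: B) =
  tdot A A + (2 * t * tdot A B + t ^+ 2 * tdot B B).
Proof. rewrite !(tdotDl, tdotDr, tdotZl, tdotZr) (tdotC B A); ring. Qed.

Lemma tdot_ge0 A : 0 <= tdot A A.
Proof. by apply: sumr_ge0 => i _; rewrite -expr2 sqr_ge0. Qed.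

Lemma tdot_eq0 A : tdot A A = 0 -> A = 0.
Proof.
move=> A0; apply: funext => i.
have /psumr_eq0P : forall j, true -> 0 <= A j * A j.
  by move=> j _; rewrite -expr2 sqr_ge0.
by move=> /(_ A0 i isT) /eqP; rewrite mulf_eq0 orbb => /eqP.
Qed.

Lemma coord_sqr_le A i : A i ^+ 2 <= tdot A A.
Proof.
rewrite /tdot (bigD1 i)//= expr2 lerDl; apply: sumr_ge0 => j _.
by rewrite -expr2 sqr_ge0.
Qed.

Lemma symt0 : symt (0 : tensor R n k). Proof. by []. Qed.

Lemma symtD A B : symt A -> symt B -> symt (A + B).
Proof. by move=> sA sB s i; rewrite !addtE sA sB. Qed.

Lemma symtZ c A : symt A -> symt (c *: A).
Proof. by move=> sA s i; rewrite !scaletE sA. Qed.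

Lemma symtB A B : symt A -> symt B -> symt (A - B).
Proof. by move=> sA sB; rewrite -scaleN1r; apply: symtD => //; exact: symtZ. Qed.

Definition convex_cone (K : set (tensor R n k)) :=
  [/\ K !=set0, (forall A B, K A -> K B -> K (A + B)) &
      forall t A, 0 < t -> K A -> K (t *: A)].

Lemma convex_cone_convex K : convex_cone K -> convex_set K.
Proof.
move=> [_ KD KZ]; apply/convex_setW => A B + + t t0 t1; rewrite !inE => KA KB.
apply: KD; apply: KZ => //; by rewrite subr_gt0.
Qed.

Lemma convex_cone_is_cone K : convex_cone K -> is_cone K.
Proof. by move=> [K0 _ KZ]. Qed.

Lemma nearest_point (K : set (tensor R n k)) A : closed K -> K !=set0 ->
  exists2 P, K P & forall Q, K Q -> tdot (P - A) (P - A) <= tdot (Q - A) (Q - A).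
Proof.
move=> Kc [Q0 KQ0]; pose d := fun Q => tdot (Q - A) (Q - A).
have dc : continuous d.
  have cB i : continuous (fun Q : tensor R n k => (Q - A) i).
    move=> Q; have H := cvgB (@coord_continuous R n k i Q) (cvg_cst (A i)).
    exact: H.
  by apply: tdot_continuous.
pose K' := K `&` [set Q | d Q <= d Q0].
have K'c : closed K' by apply: closedI => //; exact: closed_le_fun.
pose N := \sum_i `|A i|.
have K'co : compact K'.
  (* An entry of [X - A] with absolute value [y] satisfies [y ^+ 2 <= d Q0], hence [y <= d Q0 + 1];
     [N] dominates every entry of [A]. *)
  apply: (bounded_closed_compact_tensor (M := d Q0 + 1 + N)) => // X i [_ dX].
  have -> : X i = (X - A) i + A i by rewrite addtE opptE subrK.
  apply: (le_trans (ler_normD _ _)); apply: lerD; last first.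
    by rewrite /N (bigD1 i)//= lerDl sumr_ge0.
  have := le_trans (coord_sqr_le (X - A) i) dX.
  rewrite -real_normK ?num_real//.
  have := normr_ge0 ((X - A) i); move: `|_| => y y0; nra.
have K'0 : K' !=set0 by exists Q0; split => //=.
have [|P] := @compact_EVT_min _ _ d K' K'0 K'co.
  exact: continuous_subspaceT.
rewrite inE => -[KP _] Pmin; exists P => // Q KQ.
have [dQ|dQ] := leP (d Q) (d Q0); first by apply: Pmin; rewrite inE.
apply: (le_trans _ (ltW dQ)); apply: Pmin; rewrite inE; split => //=.
Qed.

(** First-order optimality: [2 * t * a + t ^+ 2 * b] will be the change of the squared distance
    along a segment starting at a nearest point. *)
Lemma small_ge0 (a b : R) : 0 <= b ->
  (forall t, 0 < t -> t < 1 -> 0 <= 2 * t * a + t ^+ 2 * b) -> 0 <= a.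
Proof.
move=> b0 H; rewrite leNgt; apply/negP => a0.
(* If [a < 0], this [t] lies strictly between 0 and 1 and [t * b < - a], so
   [2 * a + t * b < a < 0]. *)
pose t := - a / (b - a + 1).
have p : 0 < b - a + 1 by lra.
have t0 : 0 < t by rewrite /t divr_gt0// oppr_gt0.
have t1 : t < 1 by rewrite /t ltr_pdivrMr// mul1r; lra.
have := H t t0 t1.
have -> : 2 * t * a + t ^+ 2 * b = t * (2 * a + t * b) by ring.
rewrite pmulr_rge0// => h.
have : t * b < - a.
  by rewrite /t mulrAC ltr_pdivrMr// ltr_pM2l ?oppr_gt0//; lra.
lra.
Qed.

(** Let [P] be the point of [K] nearest to [A] and [W = P - A]. Optimality puts [W] in the dual cone
    and gives [tdot W P <= 0]. If [A] is in the bidual then [tdot W A >= 0], so [tdot W W <= 0] and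
    [A = P]. *)
Lemma bipolar (K : set (tensor R n k)) :
  K `<=` symt -> closed K -> convex_cone K -> dual_cone (dual_cone K) = K.
Proof.
move=> Ksym Kc [K0 KD KZ]; apply/seteqP; split => A; last first.
  move=> KA; split; first exact: Ksym.
  by move=> B [_ HB]; rewrite tdotC; exact: HB.
move=> [sA HA].
have [P KP Pmin] := nearest_point A Kc K0.
pose W := P - A.
have step B : (forall t, 0 < t -> t < 1 -> K (P + t *: B)) -> 0 <= tdot W B.
  move=> HB; apply: (small_ge0 (tdot_ge0 B)) => t t0 t1.
  have := Pmin _ (HB t t0 t1).
  by rewrite addrAC tdot_line lerDl.
have WK B : K B -> 0 <= tdot W B.
  by move=> KB; apply: step => t t0 _; apply: KD => //; exact: KZ.
(* Moving from [P] towards the origin stays in the cone, as [P - t *: P = (1 - t) *: P] with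
   [t < 1]. *)
have WP : 0 <= tdot W (- P).
  apply: step => t t0 t1; rewrite scalerN -{1}(scale1r P) -scalerBl.
  by apply: KZ => //; rewrite subr_gt0.
have dW : dual_cone K W by split => //; apply: symtB => //; exact: Ksym.
have := HA _ dW; have -> : A = P - W by rewrite /W opprB addrCA subrr addr0.
rewrite tdotC tdotDr tdotNr => h; move: WP; rewrite tdotNr => WP.
have W0 : W = 0.
  apply: tdot_eq0; apply/eqP; rewrite eq_le tdot_ge0 andbT; lra.
by rewrite W0 subr0.
Qed.

End Bipolar.

(** * Symmetrization, forms and polarization *)

Section Symmetrization.
Context {R : realType} {n : nat}.

Lemma permute_idxM k (s t : 'S_k) (i : {ffun 'I_k -> 'I_n}) :
  permute_idx s (permute_idx t i) = permute_idx (s * t)%g i.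
Proof. by apply/ffunP => j; rewrite !ffunE permM. Qed.

Lemma permute_idx1 k (i : {ffun 'I_k -> 'I_n}) : permute_idx 1%g i = i.
Proof. by apply/ffunP => j; rewrite !ffunE perm1. Qed.

Lemma sum_permute_idx k (s : 'S_k) (F : tensor R n k) :
  \sum_i F (permute_idx s i) = \sum_i F i.
Proof.
rewrite [RHS](reindex (permute_idx s))//.
exists (permute_idx s^-1) => i _; rewrite permute_idxM.
  by rewrite mulVg permute_idx1.
by rewrite mulgV permute_idx1.
Qed.

Lemma symt_symmetrize k (A : tensor R n k) : symt (symmetrize A).
Proof.
move=> t i; rewrite /symmetrize; congr (_ * _).
rewrite [RHS](reindex_inj (mulIg t)).
by apply: eq_bigr => s _; rewrite permute_idxM.
Qed.

Lemma fact_unit k : (k`!%:R : R) != 0.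
Proof. by rewrite pnatr_eq0 -lt0n fact_gt0. Qed.

Lemma symmetrize_id k (A : tensor R n k) : symt A -> symmetrize A = A.
Proof.
move=> sA; apply: funext => i; rewrite /symmetrize.
under eq_bigr do rewrite sA.
by rewrite sumr_const card_Sn -[A i *+ _]mulr_natl mulrA mulVf ?mul1r// fact_unit.
Qed.

(** Permuting the indices of both factors preserves the inner product, and [C] is invariant, so each
    of the [k]! terms of the average pairs with [C] to the same value. *)
Lemma tdot_symmetrize k (A C : tensor R n k) : symt C ->
  tdot (symmetrize A) C = tdot A C.
Proof.
move=> sC; rewrite /tdot /symmetrize.
under eq_bigr do rewrite -mulrA mulr_suml.
rewrite -mulr_sumr exchange_big/=.
have H (s : 'S_k) : \sum_i A (permute_idx s i) * C i = tdot A C.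
  rewrite /tdot -(sum_permute_idx s (fun j => A j * C j)).
  by apply: eq_bigr => i _; rewrite sC.
under eq_bigr do rewrite H.
by rewrite sumr_const card_Sn -[tdot A C *+ _]mulr_natl mulrA mulVf ?mul1r// fact_unit.
Qed.

Lemma symmetrizeD k (A B : tensor R n k) :
  symmetrize (A + B) = symmetrize A + symmetrize B.
Proof.
apply: funext => i; rewrite [RHS]addtE /symmetrize.
by under eq_bigr do rewrite addtE; rewrite big_split mulrDr.
Qed.

Lemma symmetrizeZ k c (A : tensor R n k) :
  symmetrize (c *: A) = c *: symmetrize A.
Proof.
apply: funext => i; rewrite [RHS]scaletE /symmetrize.
by under eq_bigr do rewrite scaletE; rewrite -mulr_sumr mulrCA.
Qed.

Lemma symt_eqP k (A B : tensor R n k) : symt A -> symt B ->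
  (forall C, symt C -> tdot C A = tdot C B) -> A = B.
Proof.
move=> sA sB H; apply/eqP; rewrite -subr_eq0; apply/eqP; apply: tdot_eq0.
by rewrite tdotDr tdotNr H ?subrr//; exact: symtB.
Qed.

Definition form k (A : tensor R n k) (x : 'cV[R]_n) : R := tdot A (tpow x k).

Lemma symt_tpow x k : symt (tpow x k : tensor R n k).
Proof.
move=> s i; rewrite /tpow [RHS](reindex_inj (@perm_inj _ s)).
by apply: eq_bigr => j _; rewrite ffunE.
Qed.

Lemma form_symmetrize k (A : tensor R n k) x : form (symmetrize A) x = form A x.
Proof. exact/tdot_symmetrize/symt_tpow. Qed.

(* The point whose coordinates count the selected indices. *)
Definition polar_point k (i : {ffun 'I_k -> 'I_n}) (e : {ffun 'I_k -> bool}) :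
  'cV[R]_n := \col_a \sum_t (e t && (i t == a))%:R.

(** Expanding the product of the coordinate sums chooses a slot [f j] for every factor [j]; the
    indicators then leave only the multi-index [i] composed with [f]. *)
Lemma form_polar_point k (A : tensor R n k) i e :
  form A (polar_point i e) =
  \sum_(f : {ffun 'I_k -> 'I_k}) (\prod_j (e (f j))%:R) * A [ffun j => i (f j)].
Proof.
rewrite /form /tdot /tpow.
under eq_bigr => p _ do under eq_bigr do rewrite mxE.
under eq_bigr => p _ do rewrite bigA_distr_bigA mulr_sumr.
rewrite exchange_big; apply: eq_bigr => f _ /=.
rewrite (bigD1 [ffun j => i (f j)])//= [X in _ + X]big1 ?addr0.
  rewrite mulrC; congr (_ * _); apply: eq_bigr => j _.
  by rewrite ffunE eqxx andbT.
move=> p pf; have [j pj] : exists j, p j != i (f j).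
  apply/existsP; apply: contraNT pf => /existsPn H.
  by apply/eqP/ffunP => j; rewrite ffunE; apply/eqP/negPn/H.
by rewrite (bigD1 j)//= eq_sym (negbTE pj) andbF mul0r mulr0.
Qed.

(** Inclusion-exclusion: the second product says that [e] holds on the image of [f], so the sum
    factors over the slots [t]. A slot in the image contributes [-1], one outside contributes
    [-1 + 1 = 0]; hence only surjective [f], that is injective ones, survive. *)
Lemma sign_sum_eq0 k (f : {ffun 'I_k -> 'I_k}) :
  \sum_(e : {ffun 'I_k -> bool}) (\prod_t (-1) ^+ e t) * (\prod_j (e (f j))%:R)
  = (-1) ^+ k * (injectiveb f)%:R :> R.
Proof.
have mem_codom (e : {ffun 'I_k -> bool}) :
    \prod_j (e (f j))%:R = \prod_t ((t \in codom f) ==> e t)%:R :> R.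
  have [H|/forallPn[t]] := boolP [forall t, (t \in codom f) ==> e t].
    rewrite [RHS]big1 ?big1// => [j _|t _]; last by rewrite (forallP H).
    by have := forallP H (f j); rewrite codom_f/= => ->.
  rewrite negb_imply => /andP[/codomP[j ->] ej].
  rewrite (bigD1 j)//= (negbTE ej) mul0r.
  by rewrite (bigD1 (f j))//= codom_f (negbTE ej) mul0r.
under eq_bigr do rewrite mem_codom -big_split/=.
rewrite -(bigA_distr_bigA (fun t (b : bool) => (-1) ^+ b * ((t \in codom f) ==> b)%:R)).
under eq_bigr do rewrite big_bool/= expr1 expr0 implybT implybF mulr1 mul1r.
have [fi|fi] := boolP (injectiveb f).
  have onto t : t \in codom f by apply: inj_card_onto => //; exact/injectiveP.
  under eq_bigr do rewrite onto addr0.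
  by rewrite prodr_const card_ord mulr1.
have [t tf] : exists t, t \notin codom f.
  apply/existsP; apply: contraNT fi => /existsPn H.
  apply/injectiveP => a b fab; apply: (@image_injP _ _ f predT _ _ _ _ _ fab) => //.
  by apply/eqP/eq_card => t; have := H t; rewrite negbK inE.
by rewrite (bigD1 t)//= tf addNr mul0r mulr0.
Qed.

Lemma polarization k (A : tensor R n k) i :
  \sum_(e : {ffun 'I_k -> bool}) (\prod_t (-1) ^+ e t) * form A (polar_point i e)
  = (-1) ^+ k * k`!%:R * symmetrize A i.
Proof.
under eq_bigr do rewrite form_polar_point mulr_sumr.
rewrite exchange_big/=.
under eq_bigr do under eq_bigr do rewrite mulrA.
under eq_bigr do rewrite -mulr_suml sign_sum_eq0.
rewrite (bigID (fun f : {ffun 'I_k -> 'I_k} => injectiveb f)) /= [X in _ + X]big1; last first.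
  by move=> f /negbTE ->; rewrite mulr0 mul0r.
rewrite addr0 (reindex (@pval _)) /=; last first.
  (* The default permutation is never reached, since [f] is injective here. *)
  pose in_Sn := insubd (1%g : 'S_k).
  by exists in_Sn => /= f Uf; first apply: val_inj; apply: insubdK.
rewrite /symmetrize -mulrA mulVKf ?fact_unit// mulr_sumr.
apply: eq_big => [s|s _]; first by rewrite (valP s).
rewrite (valP s) mulr1; congr (_ * A _).
by apply/ffunP => j; rewrite !ffunE pvalE.
Qed.

Lemma polarization_sym k (A : tensor R n k) i : symt A ->
  A i = (-1) ^+ k / k`!%:R *
  \sum_(e : {ffun 'I_k -> bool}) (\prod_t (-1) ^+ e t) * form A (polar_point i e).
Proof.
move=> sA; rewrite polarization symmetrize_id// [RHS]mulrA -[LHS]mul1r; congr (_ * _).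
by rewrite mulrACA -expr2 sqrr_sign mul1r mulVf// fact_unit.
Qed.

(** Polarization recovers every entry from values of the form. Identities between symmetrized
    tensors can thus be checked on polynomials. *)
Lemma symt_form_inj k (A B : tensor R n k) : symt A -> symt B ->
  form A =1 form B -> A = B.
Proof.
move=> sA sB H; apply: funext => i; rewrite !(polarization_sym i) //.
by congr (_ * _); apply: eq_bigr => e _; rewrite H.
Qed.

End Symmetrization.

(** * Tensor products and splitting of multi-indices *)

Section TensorProduct.
Context {R : realType} {n : nat}.

Definition cat_idx {k l : nat} (u : {ffun 'I_k -> 'I_n}) (v : {ffun 'I_l -> 'I_n}) :
    {ffun 'I_(k + l) -> 'I_n} :=
  [ffun j : 'I_(k + l) => match fintype.split j with inl c => u c | inr c => v c end].

Lemma cat_idxl k l (u : {ffun 'I_k -> 'I_n}) (v : {ffun 'I_l -> 'I_n}) j :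
  cat_idx u v (lshift l j) = u j.
Proof. by rewrite ffunE (unsplitK (inl j)). Qed.

Lemma cat_idxr k l (u : {ffun 'I_k -> 'I_n}) (v : {ffun 'I_l -> 'I_n}) j :
  cat_idx u v (rshift k j) = v j.
Proof. by rewrite ffunE (unsplitK (inr j)). Qed.

Lemma cat_idxE k l (i : {ffun 'I_(k + l) -> 'I_n}) :
  i = cat_idx [ffun j => i (lshift l j)] [ffun j => i (rshift k j)].
Proof.
apply/ffunP => j; case: (split_ordP j) => a ->.
  by rewrite cat_idxl ffunE.
by rewrite cat_idxr ffunE.
Qed.

Lemma sum_cat_idx k l (F : tensor R n (k + l)) :
  \sum_i F i = \sum_u \sum_v F (cat_idx u v).
Proof.
rewrite pair_big/= (reindex (fun p => cat_idx p.1 p.2))//.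
exists (fun i : {ffun 'I_(k + l) -> 'I_n} =>
  ([ffun j => i (lshift l j)], [ffun j => i (rshift k j)])).
  by move=> [u v] _ /=; congr pair; apply/ffunP => j;
    rewrite ffunE ?cat_idxl ?cat_idxr.
by move=> i _ /=; rewrite -cat_idxE.
Qed.

Lemma tprod_cat_idx k l (A : tensor R n k) (B : tensor R n l) u v :
  tprod A B (cat_idx u v) = A u * B v.
Proof.
by rewrite /tprod; congr (A _ * B _); apply/ffunP => j;
  rewrite ffunE ?cat_idxl ?cat_idxr.
Qed.

Lemma tdot_tprodE k l (G : tensor R n (k + l)) (A : tensor R n k) (B : tensor R n l) :
  tdot G (tprod A B) = \sum_u \sum_v G (cat_idx u v) * (A u * B v).
Proof.
rewrite /tdot sum_cat_idx; apply: eq_bigr => u _; apply: eq_bigr => v _.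
by rewrite tprod_cat_idx.
Qed.

Lemma tdot_tprod k l (A C : tensor R n k) (B D : tensor R n l) :
  tdot (tprod A B) (tprod C D) = tdot A C * tdot B D.
Proof.
rewrite tdot_tprodE /tdot mulr_suml; apply: eq_bigr => u _.
rewrite mulr_sumr; apply: eq_bigr => v _.
by rewrite tprod_cat_idx mulrACA.
Qed.

Lemma tpowD k l (x : 'cV[R]_n) : tpow x (k + l) = tprod (tpow x k) (tpow x l).
Proof.
apply: funext => i; rewrite (cat_idxE i) tprod_cat_idx /tpow big_split_ord.
congr (_ * _); apply: eq_bigr => j _; first by rewrite cat_idxl.
by rewrite cat_idxr.
Qed.

Lemma form_tprod k l (A : tensor R n k) (B : tensor R n l) x :
  form (tprod A B) x = form A x * form B x.
Proof. by rewrite /form tpowD tdot_tprod. Qed.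

Lemma symmetrize_tprod k l (A : tensor R n k) (B : tensor R n l) :
  symmetrize (tprod A B) = symmetrize (tprod (symmetrize A) (symmetrize B)).
Proof.
apply: symt_form_inj; try exact: symt_symmetrize.
by move=> x; rewrite !form_symmetrize !form_tprod !form_symmetrize.
Qed.

Lemma symmetrize_tprodC k (A B : tensor R n k) :
  symmetrize (tprod A B) = symmetrize (tprod B A).
Proof.
apply: symt_form_inj; try exact: symt_symmetrize.
by move=> x; rewrite !form_symmetrize !form_tprod mulrC.
Qed.

Lemma tprodDl k l (A B : tensor R n k) (C : tensor R n l) :
  tprod (A + B) C = tprod A C + tprod B C.
Proof. by apply: funext => i; rewrite [RHS]addtE /tprod addtE mulrDl. Qed.

Lemma tprodDr k l (A B : tensor R n k) (C : tensor R n l) :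
  tprod C (A + B) = tprod C A + tprod C B.
Proof. by apply: funext => i; rewrite [RHS]addtE /tprod addtE mulrDr. Qed.

Lemma tprodZl k l c (A : tensor R n k) (C : tensor R n l) :
  tprod (c *: A) C = c *: tprod A C.
Proof. by apply: funext => i; rewrite [RHS]scaletE /tprod scaletE mulrA. Qed.

Lemma tprodZr k l c (A : tensor R n k) (C : tensor R n l) :
  tprod C (c *: A) = c *: tprod C A.
Proof. by apply: funext => i; rewrite [RHS]scaletE /tprod scaletE mulrCA. Qed.

Definition unit_tensor {k} (u : {ffun 'I_k -> 'I_n}) : tensor R n k :=
  fun v => (v == u)%:R.

Lemma sum_unit_tensor k (u : {ffun 'I_k -> 'I_n}) (F : tensor R n k) :
  \sum_v F v * unit_tensor u v = F u.
Proof.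
rewrite (bigD1 u)//= big1 ?addr0 /unit_tensor ?eqxx ?mulr1// => v /negbTE ->.
by rewrite mulr0.
Qed.

Lemma tdot_unit_tensor2 k l (G : tensor R n (k + l)) u v :
  tdot G (tprod (unit_tensor u) (unit_tensor v)) = G (cat_idx u v).
Proof.
rewrite tdot_tprodE -(sum_unit_tensor u (fun u => G (cat_idx u v))).
apply: eq_bigr => u' _; rewrite -(sum_unit_tensor v (fun v => G (cat_idx u' v))).
by rewrite mulr_suml; apply: eq_bigr => v' _; rewrite mulrAC mulrA.
Qed.

End TensorProduct.

(** * Positive semidefinite Gram matrices and their decomposition into squares *)

Section Gram.
Context {R : realType} {n k : nat}.
Implicit Types (G : tensor R n (k + k)) (b c : tensor R n k).

(** [G] is read as a square matrix whose rows and columns are indexed by multi-indices of length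
    [k]; [tdot G (tprod b b)] is its quadratic form at [b]. *)
Definition sym_psd G :=
  (forall u v, G (cat_idx u v) = G (cat_idx v u)) /\
  forall b, 0 <= tdot G (tprod b b).

Lemma sym_psd_swap G b c : sym_psd G -> tdot G (tprod b c) = tdot G (tprod c b).
Proof.
move=> [sG _]; rewrite !tdot_tprodE exchange_big; apply: eq_bigr => u _ /=.
by apply: eq_bigr => v _; rewrite sG [b v * _]mulrC.
Qed.

Lemma sym_psd_diag_ge0 G u : sym_psd G -> 0 <= G (cat_idx u u).
Proof. by move=> [_ /(_ (unit_tensor u))]; rewrite tdot_unit_tensor2. Qed.

Lemma sym_psd_line G b c (t : R) : sym_psd G ->
  tdot G (tprod (b + t *: c) (b + t *: c)) =
  tdot G (tprod b b) + 2 * t * tdot G (tprod b c) + t ^+ 2 * tdot G (tprod c c).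
Proof.
move=> pG; rewrite !(tprodDl, tprodDr, tprodZl, tprodZr, tdotDr, tdotZr).
rewrite (sym_psd_swap c b pG); ring.
Qed.

(** Evaluate the quadratic form at the sum and at the difference of the two unit tensors. *)
Lemma sym_psd_offdiag G u v : sym_psd G ->
  2 * `|G (cat_idx u v)| <= G (cat_idx u u) + G (cat_idx v v).
Proof.
move=> pG; have H t := sym_psd_line (unit_tensor u) (unit_tensor v) t pG.
have := pG.2 (unit_tensor u + 1 *: unit_tensor v).
have := pG.2 (unit_tensor u + (-1) *: unit_tensor v).
rewrite !H !tdot_unit_tensor2 => h1 h2.
case: (ger0P (G (cat_idx u v))) => g; lra.
Qed.

Lemma sym_psd_le_trace G i : sym_psd G ->
  `|G i| <= \sum_u G (cat_idx u u).
Proof.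
move=> pG; rewrite (cat_idxE i); move: [ffun j => _] [ffun j => _] => v u.
have D w : G (cat_idx w w) <= \sum_u G (cat_idx u u).
  rewrite [leRHS](bigD1 w)//= lerDl sumr_ge0// => z _.
  exact: sym_psd_diag_ge0.
move: (sym_psd_offdiag u v pG) (D u) (D v) => h1 h2 h3; lra.
Qed.

(** Symmetry of the columns makes the vectors produced by pivoting symmetric tensors, as the
    generators of [SOS] require. *)
Definition gram G := sym_psd G /\ forall v, symt (fun u => G (cat_idx u v)).

Lemma gram_tprod b : symt b -> gram (tprod b b).
Proof.
move=> sb; split; last by move=> v s u; rewrite !tprod_cat_idx sb.
split=> [u v|c]; first by rewrite !tprod_cat_idx mulrC.
by rewrite tdot_tprod -expr2 sqr_ge0.
Qed.

Lemma gramD G G' : gram G -> gram G' -> gram (G + G').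
Proof.
move=> [[sG pG] cG] [[sG' pG'] cG']; split; last first.
  by move=> v s u; rewrite !addtE (cG v s u) (cG' v s u).
split=> [u v|b]; first by rewrite !addtE sG sG'.
by rewrite tdotDl addr_ge0.
Qed.

Lemma gramZ (t : R) G : 0 <= t -> gram G -> gram (t *: G).
Proof.
move=> t0 [[sG pG] cG]; split; last first.
  by move=> v s u; rewrite !scaletE (cG v s u).
split=> [u v|b]; first by rewrite !scaletE sG.
by rewrite tdotZl mulr_ge0.
Qed.

(* One step of the Cholesky factorization, with pivot v. *)
Lemma gram_pivot G v : gram G -> 0 < G (cat_idx v v) ->
  exists b, [/\ symt b, gram (G - tprod b b), b v ^+ 2 = G (cat_idx v v) &
    G = tprod b b + (G - tprod b b)].
Proof.
move=> [pG cG] Gv0.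
set g := G (cat_idx v v) in Gv0 *.
pose b : tensor R n k := fun u => (Num.sqrt g)^-1 * G (cat_idx u v).
have wg : (Num.sqrt g)^-1 ^+ 2 = g^-1 by rewrite exprVn sqr_sqrtr// ltW.
have sb : symt b by move=> s u; rewrite /b (cG v s u).
exists b; split => //; last by rewrite addrC subrK.
- split; last first.
    by move=> u s w; rewrite !addtE !opptE (cG u s w) !tprod_cat_idx sb.
  split=> [u w|c].
    by rewrite !addtE !opptE pG.1 !tprod_cat_idx [b u * _]mulrC.
  rewrite tdotDl tdotNl tdot_tprod.
  have -> : tdot b c = (Num.sqrt g)^-1 * tdot G (tprod c (unit_tensor v)).
    rewrite tdot_tprodE mulr_sumr; apply: eq_bigr => u _.
    under eq_bigr do rewrite mulrA.
    rewrite (sum_unit_tensor v (fun w => G (cat_idx u w) * c u)) /b; ring.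
  rewrite -expr2 exprMn wg; set q := tdot G (tprod c (unit_tensor v)).
  (* This multiple of the unit tensor minimizes the quadratic form on the line through [c]; the
     minimum, [tdot G (tprod c c) - q ^+ 2 / g], is the quadratic form of the remainder at [c]. *)
  have := pG.2 (c + (- q / g) *: unit_tensor v).
  rewrite sym_psd_line// tdot_unit_tensor2 -/g -/q.
  congr (_ <= _); field; exact: lt0r_neq0.
- rewrite /b exprMn wg -/g; field; exact: lt0r_neq0.
Qed.

(** Induction on the number of nonzero diagonal entries: a pivoting step clears the pivot and
    creates no new one. A zero diagonal forces [G = 0] by the trace bound. *)
Lemma gram_ind (P : tensor R n (k + k) -> Prop) :
  P 0 -> (forall b G, symt b -> P G -> P (tprod b b + G)) ->
  forall G, gram G -> P G.
Proof.
move=> P0 PD G.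
have [N] := ubnP #|[pred u | G (cat_idx u u) != 0]|.
elim: N G => // N IH G NG gG.
have [D|/existsNP[v /eqP Gv]] := pselect (forall u, G (cat_idx u u) = 0).
  suff -> : G = 0 by [].
  apply: funext => i; have := sym_psd_le_trace i gG.1.
  by rewrite big1 ?normr_le0// => /eqP.
have Gv0 : 0 < G (cat_idx v v) by rewrite lt0r Gv sym_psd_diag_ge0//; exact: gG.1.
have [b [sb gb bv ->]] := gram_pivot gG Gv0.
apply: PD => //; apply: IH (gb); move: NG; rewrite ltnS; apply: leq_trans.
apply: proper_card; apply/properP; split.
  apply/fintype.subsetP => u; rewrite !inE; apply: contraNN => /eqP Gu.
  (* Where the diagonal of [G] vanishes, the remainder has the nonnegative entry [- b u ^+ 2], which
     is therefore zero. *)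
  have := sym_psd_diag_ge0 u gb.1.
  rewrite addtE opptE tprod_cat_idx Gu sub0r oppr_ge0 -expr2 => bu.
  by rewrite oppr_eq0 eq_le bu sqr_ge0.
exists v; rewrite !inE//.
by rewrite addtE opptE tprod_cat_idx -expr2 bv subrr eqxx.
Qed.

End Gram.

(** * The cones [SOS] and [MOM]: Gram description and closedness *)

Section SOSCone.
Context {R : realType} {n k : nat}.
Implicit Types (G Y : tensor R n (k + k)) (b c : tensor R n k).

Lemma sqr_sum_le (I : finType) (z : I -> R) :
  (\sum_i z i) ^+ 2 <= #|I|%:R * \sum_i z i ^+ 2.
Proof.
have -> : #|I|%:R * \sum_i z i ^+ 2 = \sum_i \sum_j (z i ^+ 2 + z j ^+ 2) / 2.
  under [RHS]eq_bigr do rewrite -mulr_suml big_split/= sumr_const.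
  rewrite -mulr_suml big_split/= sumr_const sumrMnl mulr_natl; lra.
rewrite expr2 mulr_suml; apply: ler_sum => i _.
rewrite mulr_sumr; apply: ler_sum => j _.
have := sqr_ge0 (z i - z j); lra.
Qed.

(** The squared prefactor of the polarization formula times its number of terms, the latter coming
    from Cauchy-Schwarz. *)
Definition polar_const : R := k`!%:R^-1 ^+ 2 * #|{ffun 'I_k -> bool}|%:R.

Lemma coord_sqr_le_form b u : symt b ->
  b u ^+ 2 <= polar_const * \sum_e form b (polar_point u e) ^+ 2.
Proof.
move=> sb; rewrite (polarization_sym u sb) !exprMn sqrr_sign mul1r.
rewrite /polar_const -[leRHS]mulrA ler_wpM2l ?sqr_ge0//.
apply: (le_trans (sqr_sum_le _)); rewrite ler_wpM2l// ler_sum// => e _.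
by rewrite exprMn -prodrXl [X in X * _]big1 ?mul1r// => t _; rewrite sqrr_sign.
Qed.

(** On [symmetrize (tprod b b)] the form is the square of that of [b], so this linear functional
    adds up the bounds of [coord_sqr_le_form] over all entries of [b]. *)
Definition polar_trace Y : R :=
  \sum_(u : {ffun 'I_k -> 'I_n}) polar_const * \sum_e form Y (polar_point u e).

Lemma polar_traceD Y Y' : polar_trace (Y + Y') = polar_trace Y + polar_trace Y'.
Proof.
rewrite /polar_trace -big_split; apply: eq_bigr => u _ /=.
rewrite -mulrDr -big_split; congr (_ * _); apply: eq_bigr => e _ /=.
exact: tdotDl.
Qed.

(** Both sides are additive in [G], so [gram_ind] reduces the bound to a single square
    [tprod b b]. *)
Lemma gram_trace_le G : gram G ->
  \sum_u G (cat_idx u u) <= polar_trace (symmetrize G).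
Proof.
move: G; apply: gram_ind => [|b G sb IH].
  rewrite big1// /polar_trace sumr_ge0// => u _; rewrite big1 ?mulr0// => e _.
  by rewrite form_symmetrize /form /tdot big1// => i _; rewrite mul0r.
rewrite symmetrizeD polar_traceD.
under eq_bigr do rewrite addtE.
rewrite big_split; apply: lerD => //; apply: ler_sum => u _ /=.
rewrite tprod_cat_idx -expr2; apply: (le_trans (coord_sqr_le_form u sb)).
rewrite le_eqVlt; apply/orP; left; apply/eqP; congr (_ * _).
by apply: eq_bigr => e _; rewrite form_symmetrize form_tprod expr2.
Qed.

Lemma SOS_ind (K : set (tensor R n (k + k))) :
  (forall b, symt b -> K (symmetrize (tprod b b))) ->
  (forall A B, K A -> K B -> K (A + B)) ->
  (forall t A, 0 <= t -> K A -> K (t *: A)) -> SOS R n k `<=` K.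
Proof.
move=> Kb KD KZ; apply: smallest_sub; last by move=> _ [b sb <-]; exact: Kb.
move=> A B t; rewrite !inE => KA KB; apply: KD; apply: KZ => //.
by rewrite subr_ge0.
Qed.

Lemma SOS_gen b : SOS R n k (symmetrize (tprod b b)).
Proof.
rewrite symmetrize_tprod; apply: sub_smallest; first exact: subset_refl.
by exists (symmetrize b) => //; exact: symt_symmetrize.
Qed.

Lemma SOS_scale (t : R) Y : 0 <= t -> SOS R n k Y -> SOS R n k (t *: Y).
Proof.
(* The preimage of a convex set [C] under scaling by [t] is convex, and it contains the generators
   because [t] can be absorbed into [b] as its square root. *)
move=> t0 H C [cC GC]; apply: (H [set Y | C (t *: Y)]); split.
  move=> A B p; rewrite !inE => CA CB.
  have := cC (t *: A) (t *: B) p; rewrite !inE => /(_ CA CB).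
  congr (C _); rewrite /conv/= scalerDr !scalerA.
  by congr (_ *: _ + _ *: _); rewrite mulrC.
move=> _ [b sb <-]; apply: GC; exists (Num.sqrt t *: b); first exact: symtZ.
by rewrite tprodZl tprodZr !symmetrizeZ scalerA -expr2 sqr_sqrtr.
Qed.

(** The sum is the midpoint of [2 *: A] and [2 *: B]. *)
Lemma SOS_add A B : SOS R n k A -> SOS R n k B -> SOS R n k (A + B).
Proof.
move=> SA SB C [cC GC].
have C2 Y : SOS R n k Y -> C (2 *: Y).
  by move=> SY; apply: (SOS_scale _ SY).
have h0 : 0 <= 2^-1 :> R by lra.
have h1 : 2^-1 <= 1 :> R by lra.
pose p : {i01 R} := Itv01 h0 h1.
have := cC (2 *: A) (2 *: B) p; rewrite !inE => /(_ (C2 _ SA) (C2 _ SB)).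
congr (C _); rewrite /conv/= !scalerA.
have -> : (1 - 2^-1) * 2 = 1 :> R by lra.
by rewrite mulVf// !scale1r.
Qed.

Lemma SOS_gram : SOS R n k = symmetrize @` gram.
Proof.
apply/seteqP; split.
  apply: SOS_ind.
  - by move=> b sb; exists (tprod b b) => //; exact: gram_tprod.
  - move=> _ _ [G gG <-] [G' gG' <-]; exists (G + G'); first exact: gramD.
    exact: symmetrizeD.
  - move=> t _ t0 [G gG <-]; exists (t *: G); first exact: gramZ.
    exact: symmetrizeZ.
move=> _ [G gG <-]; move: G gG; apply: gram_ind => [|b G sb IH].
  rewrite -(scale0r (tprod (0 : tensor R n k) 0)) symmetrizeZ.
  by apply: SOS_scale => //; exact: SOS_gen.
by rewrite symmetrizeD; apply: SOS_add => //; exact: SOS_gen.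
Qed.

Lemma closed_gram : closed (@gram R n k).
Proof.
have -> : @gram R n k = [set G | forall u v, G (cat_idx u v) = G (cat_idx v u)]
    `&` ([set G | forall b, 0 <= tdot G (tprod b b)] `&`
    [set G | forall v s u, G (cat_idx (permute_idx s u) v) = G (cat_idx u v)]).
  by apply/seteqP; split => [G [[? ?] ?]|G [? [? ?]]]; do !split.
apply: closedI; last apply: closedI.
- do 2 (apply: closed_forall => ?).
  by apply: closed_eq_fun; exact: coord_continuous.
- apply: closed_forall => b; apply: closed_ge_fun.
  by apply: tdot_continuous => i; [exact: coord_continuous|exact: cst_continuous].
- do 3 (apply: closed_forall => ?).
  by apply: closed_eq_fun; exact: coord_continuous.
Qed.

Lemma symmetrize_continuous l i :
  continuous (fun A : tensor R n l => symmetrize A i).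
Proof.
apply: scale_continuous.
by apply: sum_continuous => s; exact: coord_continuous.
Qed.

Lemma polar_trace_continuous : continuous polar_trace.
Proof.
apply: sum_continuous => u; apply: scale_continuous.
apply: sum_continuous => e; apply: tdot_continuous => i.
  exact: coord_continuous.
exact: cst_continuous.
Qed.

Lemma closed_SOS : closed (SOS R n k).
Proof.
rewrite SOS_gram; apply: (closed_image_tensor (g := polar_trace)).
- exact: closed_gram.
- exact: symmetrize_continuous.
- exact: polar_trace_continuous.
- move=> G i gG; apply: le_trans (gram_trace_le gG).
  exact: sym_psd_le_trace gG.1.
Qed.

Lemma SOS_symt : SOS R n k `<=` symt.
Proof. by rewrite SOS_gram => _ [G _ <-]; exact: symt_symmetrize. Qed.

Lemma SOS_convex_cone : convex_cone (SOS R n k).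
Proof.
split; first by exists (symmetrize (tprod 0 0)); exact: SOS_gen.
  exact: SOS_add.
by move=> t A t0; apply: SOS_scale; exact: ltW.
Qed.

(** Here [b] ranges over all tensors: [SOS_gen] covers nonsymmetric [b] too, since symmetrizing the
    factors first does not change the symmetrized product. *)
Lemma MOMP X : MOM R n k X <-> symt X /\ forall b, 0 <= tdot X (tprod b b).
Proof.
split=> -[sX HX]; split => //.
  by move=> b; rewrite tdotC -(tdot_symmetrize _ sX) tdotC; apply: HX; exact: SOS_gen.
apply: SOS_ind => [b sb|A B|t A t0] /=.
- by rewrite tdotC tdot_symmetrize// tdotC.
- by rewrite tdotDr; exact: addr_ge0.
- by rewrite tdotZr; exact: mulr_ge0.
Qed.

Lemma MOM_sym_psd X : MOM R n k X -> sym_psd X.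
Proof.
move=> /MOMP[sX pX]; split => // u v.
rewrite -!tdot_unit_tensor2 tdotC -(tdot_symmetrize _ sX) symmetrize_tprodC.
by rewrite tdot_symmetrize// tdotC.
Qed.

Lemma dual_cone_convex_cone l (K : set (tensor R n l)) : convex_cone (dual_cone K).
Proof.
split.
- exists 0; split; first exact: symt0.
  by move=> B _; rewrite /tdot big1// => i _; rewrite mul0r.
- move=> A B [sA HA] [sB HB]; split; first exact: symtD.
  by move=> C KC; rewrite tdotDl addr_ge0 ?HA ?HB.
- move=> t A t0 [sA HA]; split; first exact: symtZ.
  by move=> C KC; rewrite tdotZl mulr_ge0 ?HA// ltW.
Qed.

Lemma closed_dual_cone l (K : set (tensor R n l)) : closed (dual_cone K).
Proof.
have -> : dual_cone K = [set A | forall s i, A (permute_idx s i) = A i] `&`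
    [set A | forall B : {B | K B}, 0 <= tdot A (sval B)].
  apply/seteqP; split => A [sA HA]; split => //.
    by move=> [B KB]; exact: HA.
  by move=> B KB; exact: (HA (exist _ B KB)).
apply: closedI.
  do 2 (apply: closed_forall => ?).
  by apply: closed_eq_fun; exact: coord_continuous.
apply: closed_forall => B; apply: closed_ge_fun.
by apply: tdot_continuous => i; [exact: coord_continuous|exact: cst_continuous].
Qed.

End SOSCone.

(** * The lift, its adjoint and the duality *)

Section Lift.
Context {R : realType} {n m r : nat}.
Implicit Types (A Y : tensor R n m) (X : tensor R n ((r + m) + (r + m))).

(* The non-symmetric tensor of the form (x^T x)^r <A, (x o x)^m>, supported on
   the diagonal of pairs of indices of length r + m. *)
Definition diag_lift A : tensor R n ((r + m) + (r + m)) := fun i =>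
  ([ffun j => i (lshift (r + m) j)] == [ffun j => i (rshift (r + m) j)])%:R *
  A [ffun j => i (lshift (r + m) (rshift r j))].

Lemma diag_lift_cat_idx A u w v :
  diag_lift A (cat_idx (cat_idx u w) v) = (cat_idx u w == v)%:R * A w.
Proof.
rewrite /diag_lift; congr (_%:R * A _).
  by congr (_ == _); apply/ffunP => j; rewrite ffunE ?cat_idxl ?cat_idxr.
by apply/ffunP => j; rewrite ffunE cat_idxl cat_idxr.
Qed.

Lemma tdot_diag_lift A X : tdot (diag_lift A) X =
  \sum_w A w * \sum_u X (cat_idx (cat_idx u w) (cat_idx u w)).
Proof.
rewrite /tdot sum_cat_idx (sum_cat_idx (fun u => \sum_v _)) exchange_big.
apply: eq_bigr => w _; rewrite mulr_sumr; apply: eq_bigr => u _ /=.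
rewrite (bigD1 (cat_idx u w))//= big1 ?addr0 ?diag_lift_cat_idx ?eqxx ?mul1r//.
by move=> v; rewrite diag_lift_cat_idx eq_sym => /negbTE ->; rewrite !mul0r.
Qed.

Lemma tpow_sqr k (x : 'cV[R]_n) u : tpow x k u ^+ 2 = tpow (hadamard_sq x) k u.
Proof. by rewrite /tpow -prodrXl; apply: eq_bigr => j _; rewrite mxE. Qed.

Lemma sum_tpow k (x : 'cV[R]_n) :
  \sum_(u : {ffun 'I_k -> 'I_n}) tpow x k u = (\sum_a x a 0) ^+ k.
Proof.
by rewrite /tpow -(bigA_distr_bigA (fun _ a => x a 0)) prodr_const card_ord.
Qed.

(** On the diagonal the entries of the power of [x] become squares; summing them over the first [r]
    indices gives the power of [x^T x]. *)
Lemma form_diag_lift A (x : 'cV[R]_n) : form (diag_lift A) x =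
  (x^T *m x) 0 0 ^+ r * tdot A (tpow (hadamard_sq x) m).
Proof.
have -> : (x^T *m x) 0 0 = \sum_a hadamard_sq x a 0.
  by rewrite mxE; apply: eq_bigr => a _; rewrite !mxE expr2.
rewrite /form tdot_diag_lift -sum_tpow /tdot mulr_sumr; apply: eq_bigr => w _.
rewrite mulrCA; congr (_ * _); rewrite mulr_suml; apply: eq_bigr => u _.
by rewrite tpowD tprod_cat_idx -expr2 tpow_sqr tpowD tprod_cat_idx.
Qed.

(** The right side satisfies the condition under [xget], so the default is not taken, and
    [symt_form_inj] gives uniqueness. *)
Lemma lift_sqE A : lift_sq r A = symmetrize (diag_lift A).
Proof.
have P : symt (symmetrize (diag_lift A)) /\ forall x : 'cV[R]_n,
    (x^T *m x) 0 0 ^+ r * tdot A (tpow (hadamard_sq x) m) =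
    tdot (symmetrize (diag_lift A)) (tpow x ((r + m) + (r + m))).
  split; first exact: symt_symmetrize.
  by move=> x; rewrite -form_diag_lift -form_symmetrize.
rewrite /lift_sq; case: xgetP => [B _ [sB HB]|/(_ _ P)//].
apply: symt_form_inj => //; first exact: P.1.
by move=> x; rewrite /form -HB P.2.
Qed.

(** The adjoint of [diag_lift]: a partial trace over the first [r] indices of the matrix [X],
    keeping the diagonal in the other [m]. *)
Definition diag_trace X : tensor R n m :=
  fun w => \sum_u X (cat_idx (cat_idx u w) (cat_idx u w)).

Lemma tdot_lift_sq A X : symt X -> tdot (lift_sq r A) X = tdot A (diag_trace X).
Proof. by move=> sX; rewrite lift_sqE tdot_symmetrize// tdot_diag_lift. Qed.

Lemma adj_lift_sqE X : symt X -> adj_lift_sq X = symmetrize (diag_trace X).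
Proof.
move=> sX.
have P : symt (symmetrize (diag_trace X)) /\ forall A, symt A ->
    tdot A (symmetrize (diag_trace X)) = tdot (lift_sq r A) X.
  split; first exact: symt_symmetrize.
  by move=> A sA; rewrite tdot_lift_sq// tdotC tdot_symmetrize// tdotC.
rewrite /adj_lift_sq; case: xgetP => [Y _ [sY HY]|/(_ _ P)//].
apply: symt_eqP => //; first exact: P.1.
by move=> C sC; rewrite HY// P.2.
Qed.

Lemma tdot_adj_lift_sq A X : symt A -> symt X ->
  tdot A (adj_lift_sq X) = tdot (lift_sq r A) X.
Proof.
move=> sA sX; rewrite adj_lift_sqE// tdot_lift_sq// tdotC tdot_symmetrize//.
exact: tdotC.
Qed.

Lemma sum_symmetrize k (B : tensor R n k) : \sum_i symmetrize B i = \sum_i B i.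
Proof.
have tdot1 (C : tensor R n k) : tdot C (fun=> 1) = \sum_i C i.
  by apply: eq_bigr => i _; rewrite mulr1.
by rewrite -!tdot1 tdot_symmetrize.
Qed.

Lemma sum_diag_trace X : \sum_w diag_trace X w = \sum_u X (cat_idx u u).
Proof. by rewrite (sum_cat_idx (fun u => X (cat_idx u u))) exchange_big. Qed.

Lemma diag_traceD X X' : diag_trace (X + X') = diag_trace X + diag_trace X'.
Proof.
apply: funext => w; rewrite [RHS]addtE /diag_trace -big_split.
by apply: eq_bigr => u _; rewrite addtE.
Qed.

Lemma diag_traceZ c X : diag_trace (c *: X) = c *: diag_trace X.
Proof.
apply: funext => w; rewrite [RHS]scaletE /diag_trace mulr_sumr.
by apply: eq_bigr => u _; rewrite scaletE.
Qed.

Lemma CconeE : Ccone R n m r =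
  (fun X => symmetrize (diag_trace X)) @` MOM R n (r + m).
Proof.
by apply/seteqP; split => _ [X MX <-]; exists X => //;
  rewrite adj_lift_sqE//; case: MX.
Qed.

Lemma Ccone_symt : Ccone R n m r `<=` symt.
Proof. by rewrite CconeE => _ [X _ <-]; exact: symt_symmetrize. Qed.

Lemma Ccone_convex_cone : convex_cone (Ccone R n m r).
Proof.
rewrite CconeE; have [[X MX] MD MZ] := dual_cone_convex_cone (SOS R n (r + m)).
split; first by exists (symmetrize (diag_trace X)), X.
  move=> _ _ [A MA <-] [B MB <-]; exists (A + B); first exact: MD.
  by rewrite diag_traceD symmetrizeD.
move=> t _ t0 [A MA <-]; exists (t *: A); first exact: MZ.
by rewrite diag_traceZ symmetrizeZ.
Qed.

Lemma closed_Ccone : closed (Ccone R n m r).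
Proof.
rewrite CconeE; apply: (closed_image_tensor (g := fun Y => \sum_i Y i)).
- exact: closed_dual_cone.
- move=> i; apply: scale_continuous; do 2 (apply: sum_continuous => ?).
  exact: coord_continuous.
- by apply: sum_continuous => i; exact: coord_continuous.
- move=> X i MX; rewrite sum_symmetrize sum_diag_trace.
  exact/sym_psd_le_trace/MOM_sym_psd.
Qed.

Lemma KNN_dual : KNN R n m r = dual_cone (Ccone R n m r).
Proof.
apply/seteqP; split => A [sA HA]; split => //.
  move=> _ [X [sX HX] <-]; rewrite tdot_adj_lift_sq// tdotC.
  exact: HX.
(* By the bipolar theorem membership in [SOS] becomes nonnegativity against [MOM], which the adjoint
   carries over to [Ccone]. *)
rewrite -(bipolar (@SOS_symt R n _) (@closed_SOS R n _) (@SOS_convex_cone R n _)).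
split; first by rewrite lift_sqE; exact: symt_symmetrize.
move=> X MX; rewrite -tdot_adj_lift_sq//; last by case: MX.
by apply: HA; exists X.
Qed.

End Lift.

Theorem proposition3p11 (R : realType) (n m r : nat)
    (hn : (1 <= n)%N) (hm : (1 <= m)%N) :
  [/\ Ccone R n m r `<=` symt, closed (Ccone R n m r),
      convex_set (Ccone R n m r) & is_cone (Ccone R n m r)] /\
  (KNN R n m r = dual_cone (Ccone R n m r) /\
   dual_cone (KNN R n m r) = Ccone R n m r).
Proof.
have cC := @Ccone_convex_cone R n m r.
split; first split.
- exact: Ccone_symt.
- exact: closed_Ccone.
- exact: convex_cone_convex.
- exact: convex_cone_is_cone.
rewrite KNN_dual; split => //.
exact: bipolar (@Ccone_symt R n m r) (@closed_Ccone R n m r) cC.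
Qed.
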